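(* Let $n\ge3$, and let $f\in\mathrm{Lie}_n[x,y]$. Set $F=f(-x-y,y)$, and write $f=f_xx+f_yy$ and $F=F_xx+F_yy$. Then the following are equivalent: (i) $f$ is special, i.e. there exists a unique $G\in\mathrm{Lie}_n[x,y]$ such that $[y,F]+[x,G]=0$. (ii) Setting $G=s'(F_x)$, the derivation $D_{F,G}$ is special. (iii) $F_y$ is antipalindromic. (iv) $F$ is push-invariant. (v) $f_y-f_x$ is antipalindromic.
   Context: $\mathbb{Q}\langle x,y\rangle$ is the ring of polynomials in non-commuting variables $x,y$; $\mathrm{Lie}[x,y]$ is the free Lie algebra inside it and $\mathrm{Lie}_n[x,y]$ its homogeneous degree $n$ part. Every polynomial $f$ without constant term is written uniquely as $f=f_xx+f_yy$. For $F,G\in\mathrm{Lie}_n[x,y]$, $D_{F,G}$ is the derivation of $\mathrm{Lie}[x,y]$ defined by $x\mapsto[x,G]$, $y\mapsto[y,F]$; it is special if $[x,G]+[y,F]=0$. (Saying that $D_{F,G}$ is special includes that $G$ is a Lie polynomial, so that $D_{F,G}$ is defined.) $\partial_x$ is the derivation of $\mathbb{Q}\langle x,y\rangle$ with $\partial_x(x)=1$, $\partial_x(y)=0$, and $s'(h)=\sum_{i\ge0}\frac{(-1)^i}{i!}\,x^i\,y\,\partial_x^i(h)$. Operators, defined on monomials and extended linearly: $anti(x^{a_0}y\cdots yx^{a_{r-1}}yx^{a_r})=x^{a_r}yx^{a_{r-1}}y\cdots yx^{a_0}$ (writing words backwards) and $push(x^{a_0}y\cdots yx^{a_{r-1}}yx^{a_r})=x^{a_r}yx^{a_0}y\cdots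 yx^{a_{r-1}}$. A polynomial $g$ homogeneous of degree $m$ is antipalindromic if $g=(-1)^m anti(g)$, and push-invariant if $push(g)=g$. (Note that $F_y$ and $f_y-f_x$ have degree $n-1$.) *)

(* Defs.v *)
From HB Require Import structures.
From mathcomp Require Import all_boot all_order all_algebra.
From mathcomp.finmap Require Import finmap.
From mathcomp.multinomials Require Import monalg.

Set Implicit Arguments.
Unset Strict Implicit.
Unset Printing Implicit Defensive.

Import GRing.Theory.
Local Open Scope ring_scope.

(* Words in x, y are elements of the free monoid on [bool]: the letter x is
   [false] and the letter y is [true]. *)
Notation letter := bool (only parsing).
Notation word := {fmonom bool}.
Notation lx := false (only parsing).
Notation ly := true (only parsing).

Notation ncpoly := {malg rat[{fmonom bool}]}.

Definition X : ncpoly := << fmu lx >>.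
Definition Y : ncpoly := << fmu ly >>.

Definition homog (n : nat) (f : ncpoly) : Prop :=
  {in msupp f, forall w : word, fdeg w = n}.

Definition br (f g : ncpoly) : ncpoly := f * g - g * f.

(* The Lie subalgebra of the free associative algebra generated by x and y
   is the free Lie algebra on x and y. *)
Inductive is_lie : ncpoly -> Prop :=
| is_lie_X : is_lie X
| is_lie_Y : is_lie Y
| is_lie_add f g : is_lie f -> is_lie g -> is_lie (f + g)
| is_lie_scale (c : rat) f : is_lie f -> is_lie (c *: f)
| is_lie_br f g : is_lie f -> is_lie g -> is_lie (br f g).

Definition lie_deg (n : nat) (f : ncpoly) : Prop := is_lie f /\ homog n f.

(* The linear extension of a map defined on words. *)
Definition lin (h : word -> ncpoly) (f : ncpoly) : ncpoly :=
  \sum_(w <- msupp f) f@_w *: h w.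

(* f(a, b). *)
Definition subst (a b : ncpoly) : ncpoly -> ncpoly :=
  lin (fun w => \prod_(c <- (w : seq letter)) (if c then b else a)).

(* The derivation with x |-> a, y |-> b, given on words by the Leibniz rule. *)
Fixpoint der_word (a b : ncpoly) (s : seq letter) : ncpoly :=
  if s is c :: s' then
    (if c then b else a) * << FMonom s' >> + << fmu c >> * der_word a b s'
  else 0.

Definition der (a b : ncpoly) : ncpoly -> ncpoly :=
  lin (fun w => der_word a b w).

Definition dx : ncpoly -> ncpoly := der 1 0.

Definition derD (F G : ncpoly) : ncpoly -> ncpoly := der (br X G) (br Y F).

(* The derivation [derD F G] is special. F and G must be Lie elements for
   [derD F G] to act on Lie[x,y] (lemma [derD_lie]). *)
Definition special_der (n : nat) (F G : ncpoly) : Prop :=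
  [/\ lie_deg n F, lie_deg n G & br X G + br Y F = 0].

(* The terms with [i >= mmeasure (@fdeg _) h] vanish (lemma [sprime_wide]);
   [mmeasure (@fdeg _) h] is 1 + the degree of h, and 0 for h = 0. *)
Definition sprime (h : ncpoly) : ncpoly :=
  \sum_(i < mmeasure (@fdeg _) h)
    ((-1) ^+ i / i`!%:R : rat) *: (X ^+ i * Y * iter i dx h).

(* [rcoef lx f] and [rcoef ly f] are f_x and f_y (lemmas [rcoef_decomp] and
   [rcoef_uniq]): keep the words ending in c and erase that letter. *)
Definition rcoef (c : letter) : ncpoly -> ncpoly :=
  lin (fun w => if rev w is d :: s then
                  if d == c then << FMonom (rev s) >> else 0
                else 0).

Definition anti : ncpoly -> ncpoly := lin (fun w => << FMonom (rev w) >>).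

(* The exponents [:: a_0; ...; a_r] of x^{a_0} y ... y x^{a_r}, and back. *)
Fixpoint exps (s : seq letter) : seq nat :=
  match s with
  | [::] => [:: 0%N]
  | false :: s' => incr_nth (exps s') 0
  | true :: s' => 0%N :: exps s'
  end.

Fixpoint of_exps (e : seq nat) : seq letter :=
  match e with
  | [::] => [::]
  | [:: a] => nseq a lx
  | a :: e' => nseq a lx ++ ly :: of_exps e'
  end.

Definition push : ncpoly -> ncpoly :=
  lin (fun w => << FMonom (of_exps (rotr 1 (exps w))) >>).

Definition antipalindromic (m : nat) (g : ncpoly) : Prop :=
  homog m g /\ g = (-1) ^+ m *: anti g.

Definition push_invariant (g : ncpoly) : Prop := push g = g.

Lemma linEw (d : {fset word}) h f : (msupp f `<=` d)%fset ->
  lin h f = \sum_(w <- d) f@_w *: h w.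
Proof.
move=> le; rewrite /lin (big_fset_incl _ le) //= => w _ /mcoeff_outdom ->.
by rewrite scale0r.
Qed.

Lemma lin_is_linear h : linear (lin h).
Proof.
move=> c f g; set d := (msupp (c *: f + g) `|` msupp f `|` msupp g)%fset.
rewrite !(@linEw d) /d; first last.
- by rewrite -fsetUA fsubsetUl.
- by rewrite [(_ `|` msupp f)%fset]fsetUC -fsetUA fsubsetUl.
- by rewrite fsubsetUr.
rewrite scaler_sumr -big_split; apply: eq_bigr => w _ /=.
by rewrite mcoeffD mcoeffZ scalerDl scalerA.
Qed.

HB.instance Definition _ h :=
  GRing.isLinear.Build rat ncpoly ncpoly *:%R (lin h) (lin_is_linear h).

Lemma lin0 h : lin h 0 = 0.
Proof. exact: linear0. Qed.

Lemma linD h f g : lin h (f + g) = lin h f + lin h g.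
Proof. exact: linearD. Qed.

Lemma linB h f g : lin h (f - g) = lin h f - lin h g.
Proof. exact: linearB. Qed.

Lemma linZ h c f : lin h (c *: f) = c *: lin h f.
Proof. exact: linearZ. Qed.

Lemma linU h w : lin h << w >> = h w.
Proof. by rewrite (linEw _ msuppU_le) big_seq_fset1 mcoeffUU scale1r. Qed.

Lemma mul_scaler (c : rat) (f g : ncpoly) : f * (c *: g) = c *: (f * g).
Proof.
apply/malgP => w; transitivity (c * (f * g)@_w); last by rewrite mcoeffZ.
rewrite [LHS](mcoeffMlw _ (fsubset_refl (msupp f)) (msuppZ_le c g)).
transitivity (c * (\sum_(u <- msupp f) \sum_(v <- msupp g)
  (f@_u * g@_v) *+ (mmul u v == w))); last by congr (_ * _); rewrite -mcoeffMl.
rewrite mulr_sumr; apply: eq_bigr => u _.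
rewrite mulr_sumr; apply: eq_bigr => v _.
by rewrite mcoeffZ mulrnAr mulrCA.
Qed.

Lemma monoE (f : ncpoly) : f = \sum_(w <- msupp f) f@_w *: << w >>.
Proof.
rewrite {1}[f]monalgE; apply: eq_bigr => w _.
by apply/malgP => v; rewrite [RHS]mcoeffZ !mcoeffU mulr_natr.
Qed.

Lemma lin_ext (D E : ncpoly -> ncpoly) : linear D -> linear E ->
  (forall s : seq letter, D << FMonom s >> = E << FMonom s >>) -> D =1 E.
Proof.
move=> hD hE DE f.
have D0 : D 0 = 0.
  by have := hD (-1) 0 0; rewrite !scaleN1r oppr0 addr0 addNr.
have E0 : E 0 = 0.
  by have := hE (-1) 0 0; rewrite !scaleN1r oppr0 addr0 addNr.
rewrite [f]monoE; elim: (enum_fset (msupp f)) => [|[w] r IH].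
  by rewrite big_nil D0 E0.
by rewrite big_cons hD hE IH DE.
Qed.

Lemma monoM (s t : seq letter) :
  (<< FMonom s >> : ncpoly) * << FMonom t >> = << FMonom (s ++ t) >>.
Proof.
rewrite malgM_def fgmulUU mulr1; congr << _ >>.
by apply/val_inj; rewrite /= fmM.
Qed.

Lemma mono_nil : (<< FMonom [::] >> : ncpoly) = 1.
Proof. by congr << _ >>; apply/val_inj; rewrite /= fm1. Qed.

Lemma mono_cons c s :
  (<< FMonom (c :: s) >> : ncpoly) = << fmu c >> * << FMonom s >>.
Proof. by rewrite fmuE monoM. Qed.

Lemma subst_X a b : subst a b X = a.
Proof. by rewrite /subst linU fmU big_seq1. Qed.

Lemma subst_Y a b : subst a b Y = b.
Proof. by rewrite /subst linU fmU big_seq1. Qed.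

Lemma subst_1 a b : subst a b 1 = 1.
Proof. by rewrite /subst -mono_nil linU big_nil mono_nil. Qed.

Lemma subst_M a b f g : subst a b (f * g) = subst a b f * subst a b g.
Proof.
pose D := subst a b; have Dl : linear D by exact: lin_is_linear.
rewrite -/D; move: f; apply: lin_ext => [c u v|c u v|s].
- by rewrite mulrDl -scalerAl Dl.
- by rewrite Dl mulrDl -scalerAl.
move: g; apply: lin_ext => [c u v|c u v|t].
- by rewrite mulrDr mul_scaler Dl.
- by rewrite Dl mulrDr mul_scaler.
by rewrite monoM /D /subst !linU /= big_cat.
Qed.

Lemma der_X a b : der a b X = a.
Proof. by rewrite /der linU fmuE /= mono_nil mulr0 addr0 mulr1. Qed.

Lemma der_Y a b : der a b Y = b.
Proof. by rewrite /der linU fmuE /= mono_nil mulr0 addr0 mulr1. Qed.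

Fact leibniz_aux (A : nzRingType) (v S T C ds dt : A) :
  v * (S * T) + C * (ds * T + S * dt) = (v * S + C * ds) * T + C * S * dt.
Proof. by rewrite mulrDl mulrDr !mulrA addrA. Qed.

Lemma der_M a b f g : der a b (f * g) = der a b f * g + f * der a b g.
Proof.
pose D := der a b; have Dl : linear D by exact: lin_is_linear.
rewrite -/D; move: f; apply: lin_ext => [c u v|c u v|s].
- by rewrite mulrDl -scalerAl Dl.
- by rewrite Dl !mulrDl -!scalerAl scalerDr addrACA.
move: g; apply: lin_ext => [c u v|c u v|t].
- by rewrite mulrDr mul_scaler Dl.
- by rewrite Dl !mulrDr !mul_scaler scalerDr addrACA.
rewrite monoM /D /der !linU /=; elim: s => [|c s IH] /=.
  by rewrite mul0r add0r mono_nil mul1r.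
have := mono_cons c s; have := monoM s t; rewrite IH.
move: << FMonom (s ++ t) >> << FMonom (c :: s) >> << FMonom s >>.
move: << FMonom t >> << fmu c >> (der_word a b s) (der_word a b t).
move: (if c then b else a) => v T C ds dt st cs S <- ->.
exact: leibniz_aux.
Qed.

Fact br_leibniz_aux (A : nzRingType) (f g df dg : A) :
  (df * g + f * dg) - (dg * f + g * df)
  = (df * g - g * df) + (f * dg - dg * f).
Proof. by rewrite opprD [- _ - _]addrC addrACA. Qed.

Lemma derD_lie F G : is_lie F -> is_lie G ->
  forall f, is_lie f -> is_lie (derD F G f).
Proof.
move=> hF hG f; rewrite /derD; elim=> {f} [||f g _ hf _ hg|c f _ hf|f g Lf hf Lg hg].
- by rewrite der_X; apply: is_lie_br => //; apply: is_lie_X.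
- by rewrite der_Y; apply: is_lie_br => //; apply: is_lie_Y.
- by rewrite /der linD; apply: is_lie_add.
- by rewrite /der linZ; apply: is_lie_scale.
set D := der _ _; have -> : D (br f g) = br (D f) g + br f (D g).
  transitivity (D (f * g) - D (g * f)); first exact: linB.
  transitivity ((D f * g + f * D g) - (D g * f + g * D f)).
    by congr (_ - _); apply: der_M.
  exact: br_leibniz_aux.
by apply: is_lie_add; apply: is_lie_br.
Qed.

Lemma rcoef_mono c s d :
  rcoef c << FMonom (rcons s d) >> = if d == c then << FMonom s >> else 0.
Proof. by rewrite /rcoef linU rev_rcons revK. Qed.

Fact decomp_aux (R : nzRingType) (A : lalgType R) (c p q a : R)
    (u1 u2 v1 v2 a1 a2 x y e : A) :
  a = c * p + q -> a1 = c *: u1 + v1 -> a2 = c *: u2 + v2 ->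
  a *: e + (a1 * x + a2 * y)
  = c *: (p *: e + (u1 * x + u2 * y)) + (q *: e + (v1 * x + v2 * y)).
Proof.
move=> -> -> ->; rewrite scalerDl -scalerA !mulrDl -!scalerAl !scalerDr.
by rewrite [RHS]addrACA; congr (_ + _); rewrite addrACA.
Qed.

Lemma rcoef_decomp (f : ncpoly) :
  f = f@_mone *: 1 + (rcoef lx f * X + rcoef ly f * Y).
Proof.
have Rl c : linear (rcoef c) by exact: lin_is_linear.
move: f; apply: (@lin_ext id) => [|c u v|s]; first by [].
- apply: decomp_aux; [|exact: Rl|exact: Rl].
  by rewrite mcoeffD; congr (_ + _); rewrite mcoeffZ.
case/lastP: s => [|s d].
  by rewrite /rcoef !linU /= !mul0r !addr0 mono_nil mcoeff1 eqxx scale1r.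
rewrite !rcoef_mono mcoeffU.
have -> : (FMonom (rcons s d) == mone) = false.
  by apply/negbTE/eqP => /(congr1 val) /=; rewrite fm1; case: s.
rewrite scale0r add0r -cats1 -monoM -fmuE.
by case: d; rewrite /= mul0r ?addr0 ?add0r.
Qed.

Lemma rcoef_uniq (f f_x f_y : ncpoly) : f = f_x * X + f_y * Y ->
  f_x = rcoef lx f /\ f_y = rcoef ly f.
Proof.
have Rl c : linear (rcoef c) by exact: lin_is_linear.
have E c d g : rcoef c (g * << fmu d >>) = if d == c then g else 0.
  move: g; apply: lin_ext => [k u v|k u v|s].
  - by rewrite mulrDl -scalerAl Rl.
  - by case: ifP; rewrite ?scaler0 ?addr0.
  by rewrite fmuE monoM cats1 rcoef_mono.
move=> ->; split; apply: esym; apply: etrans (linD _ _ _) _.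
  transitivity (f_x + 0); last by rewrite addr0.
  by congr (_ + _); [exact: (E lx lx f_x) | exact: (E lx ly f_y)].
transitivity (0 + f_y); last by rewrite add0r.
by congr (_ + _); [exact: (E ly lx f_x) | exact: (E ly ly f_y)].
Qed.

Lemma exps_neq0 s : exps s != [::].
Proof. by elim: s => [|[] s] //=; case: (exps s). Qed.

Lemma of_expsK s : of_exps (exps s) = s.
Proof.
elim: s => [|[] s IH] //=; have := exps_neq0 s.
  by case: (exps s) IH => //= a e ->.
by case: (exps s) IH => [|a [|b e]] //= ->.
Qed.

Lemma expsK e : e != [::] -> exps (of_exps e) = e.
Proof.
have pre a s b r : exps s = b :: r -> exps (nseq a lx ++ s) = (a + b)%N :: r.
  by move=> h; elim: a => [|a IH] //=; rewrite IH.
elim: e => [|a [|b e] IH] // _.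
  by rewrite /= -[nseq a _]cats0 (pre a [::] 0%N [::]) // addn0.
by rewrite [of_exps _]/= (pre a _ 0%N (b :: e)) ?addn0 //= IH.
Qed.

Lemma push_mono e : e != [::] ->
  push << FMonom (of_exps e) >> = << FMonom (of_exps (rotr 1 e)) >>.
Proof. by move=> e0; rewrite /push linU /= expsK. Qed.

Lemma of_exps_cons a e : e != [::] ->
  of_exps (a :: e) = nseq a lx ++ ly :: of_exps e.
Proof. by case: e. Qed.

Lemma of_exps_rev e : of_exps (rev e) = rev (of_exps e).
Proof.
have rn a : rev (nseq a lx) = nseq a lx.
  by apply: (@eq_from_nth _ lx); rewrite size_rev // => i /[!size_nseq] lt_ia;
     rewrite nth_rev size_nseq // !nth_nseq !if_same.
have cat1 e' a : e' != [::] ->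
    of_exps (rcons e' a) = of_exps e' ++ ly :: nseq a lx.
  elim: e' => [|b e' IH] // _; have [-> //|e'0] := eqVneq e' [::].
  rewrite rcons_cons !of_exps_cons ?IH -?catA //.
  by rewrite -size_eq0 size_rcons.
elim: e => [|a [|b e] IH] //; first by rewrite /= rn.
rewrite rev_cons cat1 ?IH; last by rewrite -size_eq0 size_rev.
by rewrite [of_exps (a :: _)]/= rev_cat rev_cons rn cat_rcons.
Qed.

Lemma anti_mono e :
  anti << FMonom (of_exps e) >> = << FMonom (of_exps (rev e)) >>.
Proof. by rewrite /anti linU of_exps_rev. Qed.

Fact iter_der0 (A : nzRingType) (D : A -> A) k : D 0 = 0 -> iter k D 0 = 0.
Proof. by move=> D0; elim: k => //= k ->. Qed.

Fact iter_der_lin (R : nzRingType) (A : lalgType R) (D : A -> A) k :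
  linear D -> linear (iter k D).
Proof. by move=> Dl c u v; elim: k => //= k ->; rewrite Dl. Qed.

Fact iter_derX (R : nzRingType) (A : lalgType R) (D : A -> A) (x g : A) k :
  linear D -> (forall f, D (x * f) = f + x * D f) ->
  iter k.+1 D (x * g) = x * iter k.+1 D g + iter k D g *+ k.+1.
Proof.
move=> Dl Dx; have DD u v : D (u + v) = D u + D v.
  by have := Dl 1 u v; rewrite !scale1r.
have D0 : D 0 = 0 by apply: (@addrI _ (D 0)); rewrite -DD !addr0.
have Dn u j : D (u *+ j) = D u *+ j.
  by elim: j => [|j IH]; rewrite ?mulr0n // !mulrS DD IH.
elim: k => [|k IH]; first by rewrite /= Dx addrC mulr1n.
rewrite iterS IH DD Dx Dn -!iterS [_ + x * _]addrC -addrA.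
by rewrite -mulrS.
Qed.

Fact iter_derY (A : nzRingType) (D : A -> A) (y g : A) k :
  (forall f, D (y * f) = y * D f) -> iter k D (y * g) = y * iter k D g.
Proof. by move=> Dy; elim: k => //= k ->. Qed.

Lemma dx_linear : linear dx.
Proof. exact: lin_is_linear. Qed.

Lemma dx_XM f : dx (X * f) = f + X * dx f.
Proof.
apply: etrans (der_M 1 0 X f) _; congr (_ + _).
by rewrite der_X mul1r.
Qed.

Lemma dx_YM f : dx (Y * f) = Y * dx f.
Proof.
apply: etrans (der_M 1 0 Y f) _; rewrite der_Y.
by apply: etrans (add0r _); congr (_ + _); apply: mul0r.
Qed.

Lemma iter_dx_mono k s : (size s < k)%N -> iter k dx << FMonom s >> = 0.
Proof.
have d0 : dx 0 = 0 by exact: lin0.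
elim: s k => [|c s IH] [|k] lt_sk;
  [by rewrite ltn0 in lt_sk | | by rewrite ltn0 in lt_sk | ].
  by rewrite iterSr /dx /der linU iter_der0.
have lt_s : (size s < k)%N := lt_sk.
rewrite mono_cons; case: c {lt_sk}.
  apply: etrans (iter_derY _ _ dx_YM) _.
  by rewrite (IH k.+1 (ltnW lt_s)) mulr0.
apply: etrans (iter_derX _ _ dx_linear dx_XM) _.
by rewrite (IH k.+1 (ltnW lt_s)) (IH k lt_s) mulr0 mul0rn addr0.
Qed.

Lemma iter_dx_eq0 m (h : ncpoly) : (mmeasure (@fdeg _) h <= m)%N ->
  iter m dx h = 0.
Proof.
move=> le_m; rewrite [h]monoE big_seq.
elim/big_rec: _ => [|[s] f sh hf]; first by rewrite iter_der0 //; exact: lin0.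
rewrite (iter_der_lin _ dx_linear) hf iter_dx_mono ?scaler0 ?addr0 //.
exact: leq_trans (mmeasure_mnm_lt (@fdeg _) sh) le_m.
Qed.

Lemma sprime_wide N (h : ncpoly) : (mmeasure (@fdeg _) h <= N)%N ->
  sprime h = \sum_(i < N) ((-1) ^+ i / i`!%:R : rat) *: (X ^+ i * Y * iter i dx h).
Proof.
move=> le_N; rewrite /sprime.
rewrite (big_ord_widen_cond N xpredT
  (fun i => ((-1) ^+ i / i`!%:R : rat) *: (X ^+ i * Y * iter i dx h)) le_N) /=.
rewrite big_mkcond; apply: eq_bigr => i _; case: ltnP => // /iter_dx_eq0 ->.
by rewrite mulr0 scaler0.
Qed.

(* Main.v *)
Require Import Defs.
From HB Require Import structures.
From mathcomp Require Import all_boot all_order all_algebra.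
From mathcomp.finmap Require Import finmap.
From mathcomp.multinomials Require Import monalg.

(* Write d for the x-derivative and G = s'(F_x).  For a Lie element F of degree
   n >= 2 one has d F = 0 and anti F = (-1)^(n-1) F, and G is the solution of
   d G = 0 whose left y-coefficient is F_x.  Hence K = [y,F] + [x,G] satisfies
   d K = 0, and its left y-coefficient is (F_y - (-1)^(n-1) anti F_y) y.  An
   element of ker d is determined by its left y-coefficient, so K = 0 if and
   only if F_y is antipalindromic.

   That K = 0 forces G to be a Lie element: let the free algebra act on itself
   by letting the letters act by ad.  Since [x,G] is Lie, it acts as ad [x,G],
   so G.x - [G,x] commutes with x and is killed by d, hence vanishes.  Evaluating
   the Dynkin operator on [x,G] then shows that Dynkin(G) - n G also commutes
   with x and is killed by d, so that n G = Dynkin(G) is Lie.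

   Comparing coefficients in K = 0 moves a power of x from the end to the front
   of a word, which is push-invariance; conversely push-invariance on words
   ending in y is (iii).  Finally F_y is the image of f_y - f_x under the
   involution x -> -x-y, y -> y, which commutes with anti. *)

Set Implicit Arguments.
Unset Strict Implicit.
Unset Printing Implicit Defensive.

Import GRing.Theory.
Local Open Scope ring_scope.

(* The properties of Q<x,y> behind the equivalence of (i), (ii), (iii) and (v).
   [cx_] and [cy_] are the right coefficients, [at_] reverses words, [dd_] and
   [eu_] are the x-derivative and the Euler derivation, and [ad_ v f] is f
   acting on v, where the letters act by ad. *)
Record free_algebra := FreeAlgebra {
  carrier :> lalgType rat;
  x_ : carrier;
  y_ : carrier;
  mulrZ_ : forall (c : rat) (f g : carrier), f * (c *: g) = c *: (f * g);
  word_ind_ : forall P : carrier -> Prop, P 1 ->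
    (forall c f g, P f -> P g -> P (c *: f + g)) ->
    (forall f, P f -> P (x_ * f)) -> (forall f, P f -> P (y_ * f)) ->
    forall f, P f;
  cx_ : {linear carrier -> carrier};
  cy_ : {linear carrier -> carrier};
  cx1_ : cx_ 1 = 0; cxx_ : forall f, cx_ (f * x_) = f;
  cxy_ : forall f, cx_ (f * y_) = 0;
  cy1_ : cy_ 1 = 0; cyx_ : forall f, cy_ (f * x_) = 0;
  cyy_ : forall f, cy_ (f * y_) = f;
  at_ : {linear carrier -> carrier};
  at1_ : at_ 1 = 1; atx_ : forall f, at_ (x_ * f) = at_ f * x_;
  aty_ : forall f, at_ (y_ * f) = at_ f * y_;
  dd_ : {linear carrier -> carrier};
  ddM_ : forall f g, dd_ (f * g) = dd_ f * g + f * dd_ g;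
  ddx_ : dd_ x_ = 1; ddy_ : dd_ y_ = 0;
  dd_nil_ : forall f, exists N, iter N dd_ f = 0;
  eu_ : {linear carrier -> carrier};
  euM_ : forall f g, eu_ (f * g) = eu_ f * g + f * eu_ g;
  eux_ : eu_ x_ = x_; euy_ : eu_ y_ = y_;
  ad_ : carrier -> {linear carrier -> carrier};
  ad1_ : forall v, ad_ v 1 = v;
  adx_ : forall v f, ad_ v (x_ * f) = x_ * ad_ v f - ad_ v f * x_;
  ady_ : forall v f, ad_ v (y_ * f) = y_ * ad_ v f - ad_ v f * y_ }.

(** * Brackets, Lie elements and derivations *)

Fact jacobi_aux (V : zmodType) (a b c e g h : V) :
  (a - b) - (c - e) - ((g - c) - (b - h)) = (a - g) - (h - e).
Proof.
rewrite !opprB addrACA !addrA !subrK -!addrA; congr (_ + _).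
by rewrite addrCA [RHS]addrCA [- h - g]addrC.
Qed.

Section FreeAlgebraTheory.

Variable A : free_algebra.
Implicit Types (f g h u v a b P G H : A).

Local Notation x := (x_ A).
Local Notation y := (y_ A).
Local Notation cx := (@cx_ A).
Local Notation cy := (@cy_ A).
Local Notation at' := (@at_ A).
Local Notation d := (@dd_ A).
Local Notation E := (@eu_ A).
Local Notation ad := (@ad_ A).

Definition brk f g := f * g - g * f.

Inductive lie : A -> Prop :=
| lie_x : lie x
| lie_y : lie y
| lie_add f g : lie f -> lie g -> lie (f + g)
| lie_scale (c : rat) f : lie f -> lie (c *: f)
| lie_brk f g : lie f -> lie g -> lie (brk f g).

(** Vanishing constant term, phrased through last letters so that [cx] and [cy] recover the two
    witnesses. *)
Definition nocst f := exists a b, f = a * x + b * y.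

Lemma lie0 : lie 0.
Proof. by rewrite -(scale0r x); apply: lie_scale; apply: lie_x. Qed.

Lemma brkDr f g h : brk f (g + h) = brk f g + brk f h.
Proof. by rewrite /brk mulrDr mulrDl opprD addrACA. Qed.

Lemma brkDl f g h : brk (f + g) h = brk f h + brk g h.
Proof. by rewrite /brk mulrDr mulrDl opprD addrACA. Qed.

Lemma brkZr c f g : brk f (c *: g) = c *: brk f g.
Proof. by rewrite /brk mulrZ_ -scalerAl scalerBr. Qed.

Lemma brkZl c f g : brk (c *: f) g = c *: brk f g.
Proof. by rewrite /brk mulrZ_ -scalerAl scalerBr. Qed.

Lemma brkN f g : brk f g = - brk g f.
Proof. by rewrite /brk opprB. Qed.

Lemma brkNr f g : brk f (- g) = - brk f g.
Proof. by rewrite /brk mulrN mulNr opprB opprK addrC. Qed.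

Lemma brkBr f g h : brk f (g - h) = brk f g - brk f h.
Proof. by rewrite brkDr brkNr. Qed.

Lemma brkff f : brk f f = 0.
Proof. by rewrite /brk subrr. Qed.

Lemma brk1 f : brk f 1 = 0.
Proof. by rewrite /brk mulr1 mul1r subrr. Qed.

Lemma brk0r f : brk f 0 = 0.
Proof. by rewrite /brk mulr0 mul0r subrr. Qed.

Lemma brk0l f : brk 0 f = 0.
Proof. by rewrite /brk mulr0 mul0r subrr. Qed.

Lemma jacobi f g h : brk (brk f g) h = brk f (brk g h) - brk g (brk f h).
Proof.
rewrite /brk !(mulrBl, mulrBr) !mulrA.
by rewrite jacobi_aux.
Qed.

Section Derivation.

Variable D : {linear A -> A}.
Hypothesis DM : forall f g, D (f * g) = D f * g + f * D g.

Lemma der_1 : D 1 = 0.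
Proof.
by apply: (@addrI _ (D 1)); have := DM 1 1; rewrite !mulr1 mul1r addr0.
Qed.

Lemma der_brk f g : D (brk f g) = brk (D f) g + brk f (D g).
Proof. by rewrite /brk linearB /= !DM opprD [X in _ + X = _]addrC addrACA. Qed.

End Derivation.

Lemma ddbrk f g : d (brk f g) = brk (d f) g + brk f (d g).
Proof. exact/der_brk/ddM_. Qed.

Lemma eubrk f g : E (brk f g) = brk (E f) g + brk f (E g).
Proof. exact/der_brk/euM_. Qed.

(** * Reversal and decompositions by first or last letter *)

Lemma atM f g : at' (f * g) = at' g * at' f.
Proof.
elim/word_ind_: f => [|c f h IHf IHh|f IH|f IH].
- by rewrite at1_ mul1r mulr1.
- by rewrite mulrDl -scalerAl !linearP IHf IHh mulrDr mulrZ_.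
- by rewrite -mulrA !atx_ IH mulrA.
- by rewrite -mulrA !aty_ IH mulrA.
Qed.

Lemma atX : at' x = x.
Proof. by rewrite -[x in LHS]mulr1 atx_ at1_ mul1r. Qed.

Lemma atY : at' y = y.
Proof. by rewrite -[y in LHS]mulr1 aty_ at1_ mul1r. Qed.

Lemma atK : involutive at'.
Proof.
move=> f; elim/word_ind_: f => [|c f h IHf IHh|f IH|f IH].
- by rewrite !at1_.
- by rewrite !linearP IHf IHh.
- by rewrite atx_ atM atX IH.
- by rewrite aty_ atM atY IH.
Qed.

Lemma rinj a b : a * x + b * y = 0 -> a = 0 /\ b = 0.
Proof.
move=> h; split.
  by have := congr1 cx h; rewrite linearD /= cxx_ cxy_ addr0 linear0.
by have := congr1 cy h; rewrite linearD /= cyx_ cyy_ add0r linear0.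
Qed.

(** Reversal turns left coefficients into right ones, which [cx] and [cy] separate. *)
Lemma linj a b : x * a + y * b = 0 -> a = 0 /\ b = 0.
Proof.
move/(congr1 at'); rewrite linearD /= !atM atX atY linear0 => /rinj[a0 b0].
by split; apply: (can_inj atK); rewrite linear0.
Qed.

Lemma ldec f : exists k a b, f = k *: 1 + (x * a + y * b).
Proof.
elim/word_ind_: f => [|c f h [k [a [b ->]]] [k' [a' [b' ->]]]|f _|f _].
- by exists 1, 0, 0; rewrite !mulr0 !addr0 scale1r.
- exists (c * k + k'), (c *: a + a'), (c *: b + b').
  rewrite !mulrDr !mulrZ_ !scalerDr scalerDl -scalerA.
  by rewrite [LHS]addrACA; congr (_ + _); rewrite addrACA.
- by exists 0, f, 0; rewrite scale0r add0r mulr0 addr0.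
- by exists 0, 0, f; rewrite scale0r add0r mulr0 add0r.
Qed.

Lemma rdec f : exists k, f = k *: 1 + (cx f * x + cy f * y).
Proof.
have [k [a [b e]]] := ldec (at' f); exists k.
have {}e : f = k *: 1 + (at' a * x + at' b * y).
  by rewrite -[f in LHS]atK e !linearD /= linearZ /= at1_ !atM atX atY.
rewrite [X in cx X]e [X in cy X]e !linearD /= !linearZ /= cx1_ cy1_ !scaler0.
by rewrite !add0r cxx_ cyy_ cxy_ cyx_ addr0 add0r.
Qed.

Lemma nocstE f : nocst f -> f = cx f * x + cy f * y.
Proof.
by move=> [a [b ->]]; rewrite !linearD /= cxx_ cyy_ cxy_ cyx_ addr0 add0r.
Qed.

Lemma nocst_lin c f g : nocst f -> nocst g -> nocst (c *: f + g).
Proof.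
move=> [a [b ->]] [a' [b' ->]]; exists (c *: a + a'), (c *: b + b').
by rewrite !mulrDl -!scalerAl scalerDr addrACA.
Qed.

Lemma nocstB f g : nocst f -> nocst g -> nocst (f - g).
Proof.
by move=> hf hg; rewrite addrC -scaleN1r; apply: nocst_lin.
Qed.

Lemma nocstMl f g : nocst g -> nocst (f * g).
Proof.
by move=> [a [b ->]]; exists (f * a), (f * b); rewrite mulrDr !mulrA.
Qed.

Lemma nocst_brk f g : nocst f -> nocst g -> nocst (brk f g).
Proof. by move=> hf hg; apply: nocstB; apply: nocstMl. Qed.

Lemma nocst_x : nocst x.
Proof. by exists 1, 0; rewrite mul1r mul0r addr0. Qed.

Lemma nocst_y : nocst y.
Proof. by exists 0, 1; rewrite mul1r mul0r add0r. Qed.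

Lemma lie_nocst P : lie P -> nocst P.
Proof.
elim=> {P} [||f g _ hf _ hg|c f _ hf|f g _ hf _ hg].
- exact: nocst_x.
- exact: nocst_y.
- by rewrite -[f]scale1r; apply: nocst_lin.
- rewrite -[_ *: f]addr0; apply: nocst_lin => //.
  by exists 0, 0; rewrite !mul0r addr0.
- exact: nocst_brk.
Qed.

Lemma nocst_cst k f : nocst f -> f = k *: 1 -> f = 0.
Proof.
move=> /nocstE -> e; have := congr1 cx e; have := congr1 cy e.
rewrite !linearD !linearZ /= cx1_ cy1_ cxx_ cyy_ cxy_ cyx_ scaler0 addr0 add0r.
by move=> -> ->; rewrite !mul0r addr0.
Qed.

(** * The kernel of the x-derivative *)

Lemma nat_scale_inj n f : f *+ n.+1 = 0 -> f = 0.
Proof.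
move/eqP; rewrite -scaler_nat scaler_eq0 => /orP[|/eqP //].
by rewrite Num.Theory.pnatr_eq0.
Qed.

(** Descent on the nilpotency order: 0 = x d^(k+1) f + (k+1) d^k f, so d^(k+1) f = 0 forces d^k f =
    0, down to k = 0. *)
Lemma dx_inj f : d (x * f) = 0 -> f = 0.
Proof.
move=> dxf; have dx g : d (x * g) = g + x * d g by rewrite ddM_ ddx_ mul1r.
have step k : iter k.+1 d f = 0 -> iter k d f = 0.
  move=> dk; have := iter_derX f k (linearP d) dx.
  rewrite iterSr dxf iter_der0 ?linear0 // dk mulr0 add0r => /esym.
  exact: nat_scale_inj.
have [N] := dd_nil_ f.
by elim: N => // N IH /step.
Qed.

(** With H = k + x a + y b, the words of [x, H] starting with y form - y b x, so b = 0; then d H = d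
    (x a) and [dx_inj] kills a. *)
Lemma brkx_cst H : brk x H = 0 -> d H = 0 -> exists k, H = k *: 1.
Proof.
have [k [a [b ->]]] := ldec H; rewrite brkDr brkZr brk1 scaler0 add0r => e.
have /linj[_ /eqP] : x * (x * a + y * b - a * x) + y * - (b * x) = 0.
  by rewrite -[RHS]e /brk mulrBr mulrDl mulrN opprD !mulrA addrA.
rewrite oppr_eq0 => /eqP bx0.
have -> : b = 0 by rewrite -(cxx_ b) bx0 linear0.
rewrite mulr0 addr0 linearD linearZ /= (der_1 (@ddM_ A)) scaler0 add0r.
by move=> /dx_inj ->; exists k; rewrite mulr0 addr0.
Qed.

Lemma brkx_inj H : nocst H -> brk x H = 0 -> d H = 0 -> H = 0.
Proof. by move=> h0 h1 h2; have [k] := brkx_cst h1 h2; apply: nocst_cst. Qed.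

(** * The adjoint action and the Dynkin operator *)

Lemma adM v f g : ad v (f * g) = ad (ad v g) f.
Proof.
elim/word_ind_: f => [|c f h IHf IHh|f IH|f IH].
- by rewrite mul1r ad1_.
- by rewrite mulrDl -scalerAl !linearP IHf IHh.
- by rewrite -mulrA !adx_ IH.
- by rewrite -mulrA !ady_ IH.
Qed.

Lemma ad_lin c u v f : ad (c *: u + v) f = c *: ad u f + ad v f.
Proof.
elim/word_ind_: f => [|k f h IHf IHh|f IH|f IH].
- by rewrite !ad1_.
- rewrite !linearP IHf IHh !scalerDr !scalerA [k * c]mulrC.
  by rewrite addrACA.
- by rewrite !adx_ IH -[LHS]/(brk _ _) brkDr brkZr.
- by rewrite !ady_ IH -[LHS]/(brk _ _) brkDr brkZr.
Qed.

Lemma ad0 f : ad 0 f = 0.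
Proof. by have := ad_lin (-1) 0 0 f; rewrite !scaleN1r oppr0 addr0 addNr. Qed.

Lemma adD u v f : ad (u + v) f = ad u f + ad v f.
Proof. by rewrite -[u]scale1r ad_lin !scale1r. Qed.

Lemma adX v : ad v x = brk x v.
Proof. by rewrite -[X in ad v X]mulr1 adx_ ad1_. Qed.

Lemma adY v : ad v y = brk y v.
Proof. by rewrite -[X in ad v X]mulr1 ady_ ad1_. Qed.

Lemma ad_dd v f : d (ad v f) = ad (d v) f.
Proof.
elim/word_ind_: f => [|k f h IHf IHh|f IH|f IH].
- by rewrite !ad1_.
- by rewrite !linearP IHf IHh.
- rewrite !adx_ -IH -[in LHS]/(brk _ _) ddbrk ddx_.
  by rewrite brkN brk1 oppr0 add0r.
- by rewrite !ady_ -IH -[in LHS]/(brk _ _) ddbrk ddy_ brk0l add0r.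
Qed.

(** The last letter acts first, and its bracket with 1 is 0. *)
Lemma ad_1_nocst f : nocst f -> ad 1 f = 0.
Proof.
move=> [a [b ->]].
by rewrite linearD /= !adM adX adY !brk1 !ad0 addr0.
Qed.

Lemma ad_lie v f : lie v -> lie (ad v f).
Proof.
move=> hv; elim/word_ind_: f => [|k f h IHf IHh|f IH|f IH].
- by rewrite ad1_.
- by rewrite linearP; apply: lie_add => //; apply: lie_scale.
- by rewrite adx_; apply: lie_brk => //; apply: lie_x.
- by rewrite ady_; apply: lie_brk => //; apply: lie_y.
Qed.

(** By Jacobi the commutator of the operators [brk f] and [brk g] is [brk (brk f g)], so acting
    letter by letter agrees with bracketing. *)
Lemma lie_ad P : lie P -> forall v, ad v P = brk P v.
Proof.
elim=> {P} [||f g _ hf _ hg|c f _ hf|f g _ hf _ hg] v.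
- exact: adX.
- exact: adY.
- by rewrite linearD /= hf hg brkDl.
- by rewrite linearZ /= hf brkZl.
- by rewrite linearB /= !adM !hf !hg -jacobi.
Qed.

(** Right-normed bracketing: a word c1...cm goes to [c1, [c2, ..., [c(m-1), cm]]], and 1 goes to
    0. *)
Definition dynkin f := ad x (cx f) + ad y (cy f).

Lemma dynkin_lin c f g : dynkin (c *: f + g) = c *: dynkin f + dynkin g.
Proof. by rewrite /dynkin !linearP addrACA scalerDr. Qed.

Lemma dynkinD f g : dynkin (f + g) = dynkin f + dynkin g.
Proof. by rewrite -[f]scale1r dynkin_lin !scale1r. Qed.

Lemma dynkinB f g : dynkin (f - g) = dynkin f - dynkin g.
Proof. by rewrite -scaleN1r addrC dynkin_lin scaleN1r addrC. Qed.

Lemma dynkinM f g : nocst g -> dynkin (f * g) = ad (dynkin g) f.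
Proof.
move=> /nocstE e; rewrite /dynkin adD -!adM.
rewrite {1 2}e mulrDr !linearD /= !mulrA cxx_ cyx_ cxy_ cyy_.
by rewrite !linear0 addr0 add0r.
Qed.

Lemma dynkin_x : dynkin x = x.
Proof.
rewrite /dynkin -[x in cx x]mul1r -[x in cy x]mul1r.
by rewrite cxx_ cyx_ ad1_ linear0 addr0.
Qed.

Lemma dynkin_y : dynkin y = y.
Proof.
rewrite /dynkin -[y in cx y]mul1r -[y in cy y]mul1r.
by rewrite cxy_ cyy_ ad1_ linear0 add0r.
Qed.

Lemma lie_dynkin f : lie (dynkin f).
Proof. by apply: lie_add; apply: ad_lie; [apply: lie_x | apply: lie_y]. Qed.

(** Dynkin-Specht-Wever, with the Euler derivation replacing the degree so that the induction runs
    without homogeneity. *)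
Lemma dynkin_lie P : lie P -> dynkin P = E P.
Proof.
elim=> {P} [||f g _ hf _ hg|c f _ hf|f g Lf hf Lg hg].
- by rewrite dynkin_x eux_.
- by rewrite dynkin_y euy_.
- by rewrite dynkinD linearD /= hf hg.
- by rewrite /dynkin !linearZ /= -scalerDr -/(dynkin f) hf.
- rewrite dynkinB !dynkinM ?hf ?hg; try exact: lie_nocst.
  by rewrite !lie_ad // eubrk addrC [brk g _]brkN opprK.
Qed.

(* [brk x G] does not see a power of x added to G; [d G = 0] excludes it. *)
Lemma lie_of_brkx (c : rat) G : c != 0 -> E G = c *: G -> nocst G ->
  nocst (cx G) -> d G = 0 -> lie (brk x G) -> lie G.
Proof.
move=> c0 EG G0 G1 dG LxG.
have adG : ad x G = brk G x.
  apply/eqP; rewrite -subr_eq0; apply/eqP; apply: brkx_inj.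
  - apply: nocstB; first exact/lie_nocst/ad_lie/lie_x.
    exact: nocst_brk G0 nocst_x.
  - have := lie_ad LxG x.
    rewrite linearB /= !adM !adX brkff ad0 subr0 brkBr => ->.
    by rewrite jacobi brkff brk0r subr0 subrr.
  (* [d] acts only on the seed of the action, and [ad 1 G] is 0 since G has no constant term. *)
  rewrite linearB /= ad_dd ddx_ ad_1_nocst // ddbrk dG ddx_ brk0l brk1.
  by rewrite addr0 subr0.
have : dynkin G - E G = 0.
  apply: brkx_inj.
  - apply: nocstB; first exact/lie_nocst/lie_dynkin.
    by rewrite EG -[_ *: _]addr0; apply: nocst_lin => //; exact/lie_nocst/lie0.
  (* The Dynkin operator sends x G - G x to [x, dynkin G] - [G, x], while E [x, G] = [x, G] +
     [x, E G]; the terms [x, G] cancel. *)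
  - have := dynkin_lie LxG.
    rewrite dynkinB !dynkinM ?dynkin_x; [|exact: nocst_x|by []].
    rewrite adX adG eubrk eux_ [brk x G]brkN [X in _ = X]addrC.
    by move/addIr => e; rewrite brkBr e subrr.
  (* Here d (dynkin G) = [ad 1 (cx G)], which is 0 because G has no term linear in x. *)
  rewrite linearB EG linearZ /= dG scaler0 subr0 /dynkin linearD /= !ad_dd.
  by rewrite ddx_ ddy_ ad0 addr0 ad_1_nocst.
move/eqP; rewrite subr_eq0 EG => /eqP e.
rewrite -[G]scale1r -(mulVf c0) -scalerA -e.
exact/lie_scale/lie_dynkin.
Qed.


(** * Euler weights and derivatives of Lie elements *)

Lemma eu1 : E 1 = 0.
Proof. exact/der_1/euM_. Qed.

Lemma dd1 : d 1 = 0.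
Proof. exact/der_1/ddM_. Qed.

Lemma dd_x f : d (x * f) = f + x * d f.
Proof. by rewrite ddM_ ddx_ mul1r. Qed.

Lemma dd_y f : d (y * f) = y * d f.
Proof. by rewrite ddM_ ddy_ mul0r add0r. Qed.

Lemma eu_x f : E (x * f) = x * (f + E f).
Proof. by rewrite euM_ eux_ mulrDr. Qed.

Lemma eu_y f : E (y * f) = y * (f + E f).
Proof. by rewrite euM_ euy_ mulrDr. Qed.

(** Infinitesimal form of the fact that [d] lowers the degree by one. *)
Lemma eu_dd f : E (d f) = d (E f) - d f.
Proof.
elim/word_ind_: f => [|k f h IHf IHh|f IH|f IH].
- by rewrite dd1 eu1 !linear0 addr0.
- by rewrite !linearP IHf IHh /= scalerDr addrACA.
- rewrite dd_x eu_x dd_x [E (_ + _)]linearD [d (_ + _)]linearD /= eu_x IH.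
  rewrite [d f + (_ - _)]addrC subrK mulrDr [f + E f + _]addrACA.
  by rewrite [RHS]addrAC subrr add0r.
- by rewrite !(dd_y, eu_y) IH linearD /= -mulrBr addrC subrK
     [d f + _]addrC addrK.
Qed.

Lemma lie_dd_cst P : lie P -> exists c, d P = c *: 1.
Proof.
elim=> {P} [||f g _ [c hf] _ [e hg]|c f _ [e hf]|f g _ [c hf] _ [e hg]].
- by exists 1; rewrite ddx_ scale1r.
- by exists 0; rewrite ddy_ scale0r.
- by exists (c + e); rewrite linearD /= hf hg scalerDl.
- by exists (c * e); rewrite linearZ /= hf scalerA.
exists 0; rewrite ddbrk hf hg brkZl brkZr brk1 brkN brk1.
by rewrite oppr0 !scaler0 addr0 scale0r.
Qed.

(** [d P] is a scalar, hence of weight 0, but it also has weight c - 1. *)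
Lemma lie_dd c P : lie P -> c != 1 -> E P = c *: P -> d P = 0.
Proof.
move=> /lie_dd_cst[k dP] c1 EP; have := eu_dd P.
rewrite EP [d (_ *: _)]linearZ /= dP linearZ /= eu1 scaler0.
rewrite -[X in _ = _ - X]scale1r -scalerBl => /esym/eqP.
by rewrite scaler_eq0 subr_eq0 (negPf c1) => /eqP.
Qed.

(** [E] kills scalars, so E f, and with it f, has no constant term. *)
Lemma eu_nocst c f : c != 0 -> E f = c *: f -> nocst f.
Proof.
move=> c0 Ef; have [k e] := rdec f.
have -> : f = c^-1 *: E f + 0 by rewrite Ef scalerA mulVf // scale1r addr0.
apply: nocst_lin; last exact/lie_nocst/lie0.
exists (E (cx f) + cx f), (E (cy f) + cy f).
rewrite [in LHS]e !linearD linearZ /= eu1 scaler0 add0r !euM_ eux_ euy_.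
by rewrite !mulrDl.
Qed.

Lemma eu_cx c f : nocst f -> E f = c *: f -> E (cx f) = (c - 1) *: cx f.
Proof.
move=> /nocstE e Ef; have := congr1 cx Ef.
rewrite {1}e linearD !euM_ eux_ euy_ !linearD /= !cxx_ !cxy_ !addr0 linearZ /=.
by rewrite scalerBl scale1r => <-; rewrite addrK.
Qed.

Lemma eu_cy c f : nocst f -> E f = c *: f -> E (cy f) = (c - 1) *: cy f.
Proof.
move=> /nocstE e Ef; have := congr1 cy Ef.
rewrite {1}e linearD !euM_ eux_ euy_ !linearD /= !cyx_ !cyy_ !add0r linearZ /=.
by rewrite scalerBl scale1r => <-; rewrite addrK.
Qed.

(** * The operator s' *)

(** The cutoff N is explicit because the abstract algebra carries no degree function; it is used
    with [iter N d h = 0]. *)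
Definition sp N h :=
  \sum_(i < N) ((-1) ^+ i / i`!%:R : rat) *: (x ^+ i * y * iter i d h).

Lemma ddXn i : d (x ^+ i.+1) = x ^+ i *+ i.+1.
Proof.
elim: i => [|i IH]; first by rewrite expr1 ddx_.
by rewrite exprS ddM_ IH ddx_ mul1r mulrnAr -exprS [in RHS]mulrS.
Qed.

(** Telescoping: differentiating x^i in term i cancels the derivative of d^(i-1) h in term i - 1, so
    only the top derivative survives. *)
Lemma dd_sp_rec N h :
  d (sp N.+1 h) =
  ((-1) ^+ N / N`!%:R : rat) *: (x ^+ N * y * iter N.+1 d h).
Proof.
elim: N => [|N IH].
  by rewrite /sp big_ord1 linearZ /= ![x ^+ 0]expr0 ![1 * y]mul1r dd_y.
rewrite /sp big_ord_recr linearD /= -/(sp N.+1 h) IH linearZ /= !ddM_ ddXn ddy_.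
rewrite mulr0 addr0 scalerDr addrA mulrnAl mulrnAl -scaler_nat scalerA.
rewrite -scalerDl [X in X *: _ + _](_ : _ = 0) ?scale0r ?add0r //.
rewrite factS mulnC natrM exprS mulN1r invfM !mulNr -!mulrA.
rewrite mulVf ?mulr1 ?subrr //.
by rewrite Num.Theory.pnatr_eq0.
Qed.

Lemma dd_sp N h : iter N d h = 0 -> d (sp N h) = 0.
Proof.
case: N => [|N] hN; first by rewrite /sp big_ord0 linear0.
by rewrite dd_sp_rec hN mulr0 scaler0.
Qed.

(** Only term 0 begins with y. For N = 0 the sum is empty and the hypothesis says h = 0. *)
Lemma sp_head N h : iter N d h = 0 -> exists m, sp N h = y * h + x * m.
Proof.
case: N => [/= ->|N _].
  by exists 0; rewrite /sp big_ord0 !mulr0 addr0.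
rewrite /sp big_ord_recl /= !expr0 !mul1r invr1 scale1r.
exists (\sum_(i < N) ((-1) ^+ i.+1 / i.+1`!%:R : rat)
          *: (x ^+ i * y * iter i.+1 d h)).
congr (_ + _); rewrite mulr_sumr; apply: eq_bigr => i _.
by rewrite /bump /= add1n add0n mulrZ_ [x ^+ i.+1]exprS !mulrA.
Qed.

Lemma euXn i : E (x ^+ i) = i%:R *: x ^+ i.
Proof.
elim: i => [|i IH]; first by rewrite expr0 eu1 scale0r.
by rewrite exprS euM_ IH eux_ mulrZ_ mulrS scalerDl scale1r.
Qed.

Lemma eu_iter_dd c h i : E h = c *: h ->
  E (iter i d h) = (c - i%:R) *: iter i d h.
Proof.
move=> Eh; elim: i => [|i IH]; first by rewrite subr0.
rewrite iterS eu_dd IH linearZ /=.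
by rewrite -[X in _ - X]scale1r -scalerBl -addrA -opprD -natr1.
Qed.

(** Term i has weight i + 1 + (c - i). *)
Lemma eu_sp c N h : E h = c *: h -> E (sp N h) = (c + 1) *: sp N h.
Proof.
move=> Eh; rewrite /sp linear_sum scaler_sumr; apply: eq_bigr => i _.
rewrite linearZ /= !euM_ euXn euy_ (eu_iter_dd _ Eh) mulrZ_.
move: (_ / _ : rat) => k.
rewrite [RHS]scalerA [_ * k]mulrC -scalerA; congr (_ *: _).
rewrite -scalerAl -{2}[x ^+ i * y]scale1r -scalerDl -scalerAl -scalerDl.
by rewrite addrC addrA subrK.
Qed.

(** * The equation [y, F] + [x, G] = 0 *)

(** Sorting by first letter isolates the y-part F - b' y - v x, from which both directions below are
    read off. *)
Lemma brk_split F a' b' G k u v :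
  F = x * a' + y * b' -> G = k *: 1 + (x * u + y * v) ->
  brk y F + brk x G
  = x * (x * u + y * v - u * x - a' * y) + y * (F - b' * y - v * x).
Proof.
move=> F1 ->; rewrite brkDr brkZr brk1 scaler0 add0r {2}/brk.
rewrite [in LHS]/brk [X in _ - X * y]F1 !mulrDl addrC !opprD !mulrBr !mulrA.
rewrite -!addrA; do 2!congr (_ + _); by rewrite addrC -!addrA [RHS]addrCA.
Qed.

(** The y-part F - b' y - v x vanishes, and its last-y coefficient is cy F - b'. *)
Lemma special_cy F G a' b' : brk y F + brk x G = 0 -> nocst F ->
  F = x * a' + y * b' -> cy F = b'.
Proof.
move=> e /nocstE F1 F2; have [k [u [v Guv]]] := ldec G.
move: e; rewrite (brk_split F2 Guv) => /linj[_] /(congr1 cy).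
rewrite {1}F1 !linearB linearD /= !cyx_ !cyy_ add0r subr0 linear0 => /eqP.
by rewrite subr_eq0 => /eqP.
Qed.

(** With b' = cy F and v = cx F the y-part vanishes, so the sum is x w; it is killed by [d], hence w
    = 0 by [dx_inj]. *)
Lemma cy_special F a' m G : d F = 0 -> nocst F -> F = x * a' + y * cy F ->
  d G = 0 -> G = y * cx F + x * m -> brk y F + brk x G = 0.
Proof.
move=> dF /nocstE F1 F2 dG G1.
have /(brk_split F2) e : G = 0 *: 1 + (x * m + y * cx F).
  by rewrite scale0r add0r addrC.
move: e; rewrite [X in y * (X - _ - _)]F1 addrK subrr mulr0 addr0 => e.
have : d (brk y F + brk x G) = 0.
  rewrite linearD /= !ddbrk dF dG ddx_ ddy_ !brk0l !brk0r !add0r addr0.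
  by rewrite brkN brk1 oppr0.
by rewrite e => /dx_inj ->; rewrite mulr0.
Qed.

Lemma sp_special c N F a' (G := sp N (cx F)) :
  lie F -> E F = c *: F -> c != 0 -> c != 1 -> iter N d (cx F) = 0 ->
  F = x * a' + y * cy F -> [/\ lie G, E G = c *: G & brk y F + brk x G = 0].
Proof.
move=> LF EF c0 c1 dN Fl; have F0 := lie_nocst LF.
have dF := lie_dd LF c1 EF; have dG : d G = 0 by exact: dd_sp.
have EG : E G = c *: G by rewrite (eu_sp N (eu_cx F0 EF)) subrK.
have [m Gm] := sp_head dN.
have e : brk y F + brk x G = 0 by exact: (cy_special dF F0 Fl dG Gm).
have G0 := eu_nocst c0 EG; split=> //.
apply: (lie_of_brkx c0 EG G0 _ dG).
  (* [cx G] has weight c - 1, which is nonzero. *)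
  by apply: (eu_nocst _ (eu_cx G0 EG)); rewrite subr_eq0.
(* [x, G] = - [y, F] is a Lie element. *)
move/eqP: e; rewrite addrC addr_eq0 => /eqP ->.
by rewrite -scaleN1r; apply/lie_scale/lie_brk => //; exact: lie_y.
Qed.

(** Yields the uniqueness of G: the difference commutes with x and is killed by [d]. *)
Lemma lie_brkx_inj c G H : lie G -> lie H -> c != 1 -> E G = c *: G ->
  E H = c *: H -> brk x G = brk x H -> G = H.
Proof.
move=> LG LH c1 EG EH e; apply/eqP; rewrite -subr_eq0; apply/eqP.
apply: brkx_inj; first exact: nocstB (lie_nocst LG) (lie_nocst LH).
  by rewrite brkBr e subrr.
by rewrite linearB /= (lie_dd LG c1 EG) (lie_dd LH c1 EH) subrr.
Qed.

(** Reversal exchanges first and last letters, so the right coefficients determine the left ones; e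
    will be (-1)^(n-1). *)
Lemma at_left e F : e * e = 1 -> nocst F -> at' F = e *: F ->
  F = x * (e *: at' (cx F)) + y * (e *: at' (cy F)).
Proof.
move=> ee /nocstE F1 aF; rewrite !mulrZ_ -scalerDr -{1}atX -{1}atY -!atM.
by rewrite -linearD -F1 aF scalerA ee scale1r.
Qed.

(** * The sign change of both letters and the involution x -> -x-y, y -> y *)

Section Endomorphism.

Variable phi : {linear A -> A}.
Hypotheses (phi1 : phi 1 = 1) (phiM : forall f g, phi (f * g) = phi f * phi g).

(** Reversal composed with the sign change [phi] is the antipode, which is -1 on Lie elements. *)
Lemma lie_at : phi x = - x -> phi y = - y -> forall P, lie P -> at' P = - phi P.
Proof.
move=> phix phiy P; elim=> {P} [||f g _ hf _ hg|c f _ hf|f g _ hf _ hg].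
- by rewrite atX phix opprK.
- by rewrite atY phiy opprK.
- by rewrite !linearD /= hf hg.
- by rewrite !linearZ /= hf.
by rewrite /brk !linearB /= !phiM !atM hf hg !mulrNN opprK addrC.
Qed.

Hypotheses (phix : phi x = - x - y) (phiy : phi y = y).

Lemma phi_lie P : lie P -> lie (phi P).
Proof.
elim=> {P} [||f g _ hf _ hg|c f _ hf|f g _ hf _ hg].
- rewrite phix -scaleN1r -[- y]scaleN1r.
  by apply: lie_add; apply: lie_scale; [apply: lie_x|apply: lie_y].
- by rewrite phiy; apply: lie_y.
- by rewrite linearD; apply: lie_add.
- by rewrite linearZ; apply: lie_scale.
by rewrite /brk linearB /= !phiM; apply: lie_brk.
Qed.

Lemma phiK : involutive phi.
Proof.
move=> f; elim/word_ind_: f => [|k f h IHf IHh|f IH|f IH].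
- by rewrite !phi1.
- by rewrite !linearP IHf IHh.
- by rewrite !phiM IH phix linearB linearN /= phix phiy opprD !opprK addrK.
- by rewrite !phiM IH !phiy.
Qed.

Lemma at_phi f : at' (phi f) = phi (at' f).
Proof.
elim/word_ind_: f => [|k f h IHf IHh|f IH|f IH].
- by rewrite at1_ phi1 at1_.
- by rewrite !linearP IHf IHh.
- by rewrite atx_ !phiM atM IH phix linearB linearN /= atX atY.
- by rewrite aty_ !phiM atM IH phiy atY.
Qed.

Lemma eu_phi f : E (phi f) = phi (E f).
Proof.
elim/word_ind_: f => [|k f h IHf IHh|f IH|f IH].
- by rewrite phi1 eu1 linear0.
- by rewrite !linearP IHf IHh.
- rewrite !(phiM, euM_) linearD /= !phiM IH eux_ phix linearB linearN /=.
  by rewrite eux_ euy_.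
- by rewrite !(phiM, euM_) linearD /= !phiM IH euy_ phiy euy_.
Qed.

(** The image of f_x x + f_y y is - phi(f_x) x + phi(f_y - f_x) y, since x contributes to both
    letters. *)
Lemma cy_phi f : nocst f -> cy (phi f) = phi (cy f - cx f).
Proof.
move=> /nocstE e; rewrite {1}e linearD /= !phiM phix phiy mulrBr mulrN.
by rewrite !linearD !linearN /= cyx_ !cyy_ oppr0 add0r addrC.
Qed.

End Endomorphism.

End FreeAlgebraTheory.

(** * Noncommutative polynomials as an instance of [free_algebra] *)

Lemma nc_word_ind (P : ncpoly -> Prop) : P 1 ->
  (forall c f g, P f -> P g -> P (c *: f + g)) ->
  (forall f, P f -> P (X * f)) -> (forall f, P f -> P (Y * f)) ->
  forall f, P f.
Proof.
move=> P1 Plin PX PY f.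
have P0 : P 0 by have := Plin (-1) _ _ P1 P1; rewrite scaleN1r addNr.
have Pw s : P << FMonom s >>.
  elim: s => [|c s IH]; first by rewrite mono_nil.
  by rewrite mono_cons; case: c; [exact: PY|exact: PX].
rewrite [f]monoE; elim: (enum_fset (msupp f)) => [|[w] r IH].
  by rewrite big_nil.
by rewrite big_cons; apply: Plin; [exact: Pw|exact: IH].
Qed.

HB.instance Definition _ c := GRing.isLinear.Build rat ncpoly ncpoly *:%R
  (rcoef c) (lin_is_linear _).
HB.instance Definition _ := GRing.isLinear.Build rat ncpoly ncpoly *:%R
  anti (lin_is_linear _).
HB.instance Definition _ := GRing.isLinear.Build rat ncpoly ncpoly *:%R
  dx (lin_is_linear _).
HB.instance Definition _ a b := GRing.isLinear.Build rat ncpoly ncpoly *:%R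
  (der a b) (lin_is_linear _).
HB.instance Definition _ a b := GRing.isLinear.Build rat ncpoly ncpoly *:%R
  (subst a b) (lin_is_linear _).

Definition ad_act (v : ncpoly) : ncpoly -> ncpoly :=
  lin (fun w => foldr (fun c u => br << fmu c >> u) v w).

HB.instance Definition _ v := GRing.isLinear.Build rat ncpoly ncpoly *:%R
  (ad_act v) (lin_is_linear _).

Lemma rcoef1 c : rcoef c 1 = 0.
Proof. by rewrite -mono_nil /rcoef linU. Qed.

Lemma rcoef_mul c e f : rcoef c (f * << fmu e >>) = if e == c then f else 0.
Proof.
move: f; apply: lin_ext => [k u v|k u v|s].
- rewrite mulrDl -scalerAl; exact: lin_is_linear.
- by case: ifP; rewrite ?scaler0 ?addr0.
by rewrite fmuE monoM cats1 rcoef_mono.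
Qed.

Lemma rcoef_xx f : rcoef lx (f * X) = f. Proof. exact: (rcoef_mul lx lx). Qed.
Lemma rcoef_xy f : rcoef lx (f * Y) = 0. Proof. exact: (rcoef_mul lx ly). Qed.
Lemma rcoef_yx f : rcoef ly (f * X) = 0. Proof. exact: (rcoef_mul ly lx). Qed.
Lemma rcoef_yy f : rcoef ly (f * Y) = f. Proof. exact: (rcoef_mul ly ly). Qed.

Lemma anti1 : anti 1 = 1.
Proof. by rewrite -mono_nil /anti linU. Qed.

Lemma anti_mul c f : anti (<< fmu c >> * f) = anti f * << fmu c >>.
Proof.
move: f; apply: lin_ext => [k u v|k u v|s].
- rewrite mulrDr mul_scaler; exact: lin_is_linear.
- have -> : anti (k *: u + v) = k *: anti u + anti v by exact: lin_is_linear.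
  by rewrite mulrDl -scalerAl.
by rewrite -mono_cons /anti !linU /= rev_cons -cats1 -monoM fmuE.
Qed.

Lemma dx_nil f : exists N, iter N dx f = 0.
Proof. by eexists; apply: (iter_dx_eq0 (leqnn _)). Qed.

Lemma ad_act1 v : ad_act v 1 = v.
Proof. by rewrite -mono_nil /ad_act linU. Qed.


Lemma br_linear g : linear (br g).
Proof.
move=> k u v; rewrite /br mulrDr mulrDl mul_scaler -scalerAl scalerBr opprD.
by rewrite addrACA.
Qed.

Lemma ad_act_mul v c f :
  ad_act v (<< fmu c >> * f) = br << fmu c >> (ad_act v f).
Proof.
move: f; apply: lin_ext => [k u w|k u w|s].
- rewrite mulrDr mul_scaler; exact: lin_is_linear.
- have -> : ad_act v (k *: u + w) = k *: ad_act v u + ad_act v w.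
    exact: lin_is_linear.
  exact: br_linear.
by rewrite -mono_cons /ad_act !linU /=.
Qed.

Definition nc_free : free_algebra :=
  @FreeAlgebra _ X Y mul_scaler nc_word_ind
    (rcoef lx) (rcoef ly) (rcoef1 lx) rcoef_xx rcoef_xy
    (rcoef1 ly) rcoef_yx rcoef_yy
    anti anti1 (anti_mul lx) (anti_mul ly)
    dx (der_M 1 0) (der_X 1 0) (der_Y 1 0) dx_nil
    (der X Y) (der_M X Y) (der_X X Y) (der_Y X Y)
    ad_act ad_act1 (fun v => ad_act_mul v lx) (fun v => ad_act_mul v ly).

Lemma is_lieE f : is_lie f <-> @lie nc_free f.
Proof.
split; elim=> {f} [||f g _ hf _ hg|c f _ hf|f g _ hf _ hg].
- exact: (lie_x nc_free).
- exact: (lie_y nc_free).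
- exact: (@lie_add nc_free).
- exact: (@lie_scale nc_free).
- exact: (@lie_brk nc_free).
- exact: is_lie_X.
- exact: is_lie_Y.
- exact: is_lie_add.
- exact: is_lie_scale.
- exact: is_lie_br.
Qed.

(** * Homogeneity and coefficients of words *)

Lemma euler_mono s : der X Y << FMonom s >> = (size s)%:R *: << FMonom s >>.
Proof.
elim: s => [|c s IH]; first by rewrite /der linU /= scale0r.
rewrite /der linU /=; have := IH; rewrite /der linU => -> /=.
have -> : (if c then Y else X) = << fmu c >> by case: c.
by rewrite mul_scaler -mono_cons mulrS scalerDl scale1r.
Qed.

(** Scalars are embedded as multiples of 1 so that [lin_ext], which concerns polynomial-valued maps,
    applies to functionals. *)
Lemma mcoeff_ext (D E : ncpoly -> rat) : linear_for *%R D -> linear_for *%R E ->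
  (forall s : seq bool, D << FMonom s >> = E << FMonom s >>) -> D =1 E.
Proof.
move=> hD hE DE f; pose k c : ncpoly := c *: 1.
have kl (h : ncpoly -> rat) : linear_for *%R h -> linear (fun g => k (h g)).
  by move=> hl c u v; rewrite /k hl scalerDl scalerA.
have /(congr1 (mcoeff mone)) : k (D f) = k (E f).
  apply: (lin_ext (kl _ hD) (kl _ hE)) => s; congr (k _); exact: DE.
have e c : (k c)@_mone = c :> rat.
  by transitivity (c * (1 : ncpoly)@_mone);
     [exact: mcoeffZ|rewrite mcoeff1 eqxx mulr1].
by move=> h; exact: etrans (esym (e _)) (etrans h (e _)).
Qed.

Lemma mcoeff_linear w : linear_for *%R (mcoeff w : ncpoly -> rat).
Proof. by move=> c u v; rewrite mcoeffD; congr (_ + _); apply: mcoeffZ. Qed.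

Lemma mcoeff_lin (h : ncpoly -> ncpoly) w : linear h ->
  linear_for *%R (fun f => (h f)@_w).
Proof. by move=> hl c u v; rewrite hl; apply: mcoeff_linear. Qed.

Lemma euler_coef f w : (der X Y f)@_w = (fdeg w)%:R * f@_w.
Proof.
have hE : linear_for *%R (fun f : ncpoly => (fdeg w)%:R * f@_w).
  by move=> c u v; rewrite mcoeff_linear mulrDr mulrCA.
move: f; apply: (mcoeff_ext _ hE) => [|s].
  by apply: mcoeff_lin; apply: lin_is_linear.
rewrite euler_mono mcoeffZ mcoeffU; case: eqP => [<- //|_].
by rewrite !mulr0.
Qed.

(** In characteristic 0 distinct degrees are distinct Euler eigenvalues; the support condition
    becomes an equation usable in [free_algebra]. *)
Lemma homogE n f : homog n f <-> der X Y f = n%:R *: f.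
Proof.
split=> [h|e w].
  apply/malgP => w; rewrite euler_coef mcoeffZ.
  have [wf|/mcoeff_outdom ->] := boolP (w \in msupp f); last by rewrite !mulr0.
  by rewrite (h w wf).
rewrite -mcoeff_neq0 => fw; have := congr1 (mcoeff w) e.
rewrite euler_coef mcoeffZ => /(mulIf fw) /eqP.
by rewrite Num.Theory.eqr_nat => /eqP.
Qed.

Lemma subst_sign n f : homog n f -> subst (- X) (- Y) f = (-1) ^+ n *: f.
Proof.
move=> h; rewrite /subst /lin [f in RHS]monoE scaler_sumr.
rewrite big_seq [RHS]big_seq; apply: eq_bigr => [[s] /h /= <-].
rewrite scalerA mulrC -scalerA; congr (_ *: _); rewrite fdegE /=.
elim: s => [|c s IH]; first by rewrite big_nil mono_nil scale1r.
rewrite big_cons IH mul_scaler mono_cons exprS mulN1r scaleNr -scalerN -mulNr.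
case: c; exact: erefl.
Qed.

Lemma sprimeE h : exists N, sprime h = @sp nc_free N h /\ iter N dx h = 0.
Proof.
exists (mmeasure (@fdeg _) h); split; last exact: iter_dx_eq0.
by [].
Qed.

Lemma coefM_last c e f s :
  (f * << fmu e >> : ncpoly)@_(FMonom (rcons s c)) = f@_(FMonom s) *+ (e == c).
Proof.
have hE : linear_for *%R (fun f : ncpoly => f@_(FMonom s) *+ (e == c)).
  by move=> k u v; rewrite mcoeff_linear mulrnDl mulrnAr.
move: f; apply: (mcoeff_ext _ hE) => [|t].
  by apply: mcoeff_lin => k u v; rewrite mulrDl -scalerAl.
rewrite fmuE monoM cats1 !mcoeffU -mulrnA mulnb; congr (_ *+ nat_of_bool _).
by rewrite !fmP /= eqseq_rcons.
Qed.

Lemma coefM_head c e f s :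
  (<< fmu e >> * f : ncpoly)@_(FMonom (c :: s)) = f@_(FMonom s) *+ (e == c).
Proof.
have hE : linear_for *%R (fun f : ncpoly => f@_(FMonom s) *+ (e == c)).
  by move=> k u v; rewrite mcoeff_linear mulrnDl mulrnAr.
move: f; apply: (mcoeff_ext _ hE) => [|t].
  by apply: mcoeff_lin => k u v; rewrite mulrDr mul_scaler.
rewrite -mono_cons !mcoeffU -mulrnA mulnb andbC; congr (_ *+ nat_of_bool _).
Qed.

(** * Push on words *)

Definition push_word (s : seq bool) := of_exps (rotr 1 (exps s)).

Lemma push_word_bij : bijective push_word.
Proof.
have rn (T : eqType) k (e : seq T) : e != [::] -> rot k e != [::].
  by rewrite -!size_eq0 size_rot.
have rrn (T : eqType) k (e : seq T) : e != [::] -> rotr k e != [::].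
  by rewrite -!size_eq0 size_rotr.
exists (fun s => of_exps (rot 1 (exps s))) => s; rewrite /push_word expsK.
- by rewrite rotrK of_expsK.
- exact/rrn/exps_neq0.
- by rewrite rotK of_expsK.
- exact/rn/exps_neq0.
Qed.

Lemma push_coef f s : (push f)@_(FMonom (push_word s)) = f@_(FMonom s).
Proof.
move: f; apply: (mcoeff_ext _ (@mcoeff_linear _)) => [|t].
  exact/mcoeff_lin/lin_is_linear.
rewrite /push linU !mcoeffU; congr (_ *+ nat_of_bool _).
by rewrite !fmP /= (bij_eq push_word_bij).
Qed.

Lemma push_invariantE f : push_invariant f <->
  forall s, f@_(FMonom (push_word s)) = f@_(FMonom s).
Proof.
split=> [e s|e]; first by rewrite -[in LHS]e push_coef.
apply/malgP => -[s]; have [h _ hK] := push_word_bij.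
by rewrite -(hK s) push_coef e.
Qed.

Lemma exps_nseq a : exps (nseq a lx) = [:: a].
Proof. by elim: a => //= a ->. Qed.

Lemma push_word_nseq a : push_word (nseq a lx) = nseq a lx.
Proof. by rewrite /push_word exps_nseq. Qed.

Lemma push_word_cat u a :
  push_word (u ++ ly :: nseq a lx) = nseq a lx ++ ly :: u.
Proof.
rewrite /push_word; have -> : exps (u ++ ly :: nseq a lx) = rcons (exps u) a.
  elim: u => [|[] u IH] /=; rewrite ?exps_nseq // IH //.
  by case: (exps u) (exps_neq0 u).
by rewrite rotr1_rcons of_exps_cons ?exps_neq0 // of_expsK.
Qed.

(** The case split matching [push_word_nseq] and [push_word_cat], which replaces exponent lists from
    here on. *)
Lemma last_y s :
  (exists a, s = nseq a lx) \/ exists u a, s = u ++ ly :: nseq a lx.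
Proof.
have rc a : rcons (nseq a lx) lx = nseq a.+1 lx by elim: a => //= a ->.
elim/last_ind: s => [|s [] IH]; first by left; exists 0%N.
  by right; exists s, 0%N; rewrite cats1.
case: IH => [[a ->]|[u [a ->]]]; first by left; exists a.+1.
by right; exists u, a.+1; rewrite rcons_cat rcons_cons rc.
Qed.

(** * From the special equation to push-invariance and back to antipalindromy *)

Lemma coef_br e g c t e' : (br << fmu e >> g)@_(FMonom (c :: rcons t e'))
  = g@_(FMonom (rcons t e')) *+ (e == c) - g@_(FMonom (c :: t)) *+ (e == e').
Proof.
by rewrite -coefM_head -coefM_last; apply: mcoeffB.
Qed.

Section SpecialCoefficients.

Variables F G : ncpoly.
Hypothesis FG : br Y F + br X G = 0.

(** The next four lemmas are its cases for the first letter c and the last letter e. *)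
Lemma special_coef c t e :
  F@_(FMonom (rcons t e)) *+ (ly == c) - F@_(FMonom (c :: t)) *+ (ly == e)
  + (G@_(FMonom (rcons t e)) *+ (lx == c) - G@_(FMonom (c :: t)) *+ (lx == e))
  = 0.
Proof.
rewrite -!coef_br.
transitivity ((br Y F + br X G)@_(FMonom (c :: rcons t e))).
  by apply: esym; apply: mcoeffD.
by rewrite FG; apply: mcoeff0.
Qed.

Lemma special_coef_yy t : F@_(FMonom (ly :: t)) = F@_(FMonom (rcons t ly)).
Proof.
have := special_coef ly t ly; rewrite /= !mulr1n !mulr0n subrr addr0.
by move/eqP; rewrite subr_eq0 => /eqP.
Qed.

Lemma special_coef_yx t : G@_(FMonom (ly :: t)) = F@_(FMonom (rcons t lx)).
Proof.
have := special_coef ly t lx; rewrite /= !mulr1n !mulr0n subr0 sub0r.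
by move/eqP; rewrite subr_eq0 => /eqP.
Qed.

Lemma special_coef_xy t : G@_(FMonom (rcons t ly)) = F@_(FMonom (lx :: t)).
Proof.
have := special_coef lx t ly; rewrite /= !mulr1n !mulr0n subr0 sub0r.
by rewrite addrC => /eqP; rewrite subr_eq0 => /eqP.
Qed.

Lemma special_coef_xx t : G@_(FMonom (lx :: t)) = G@_(FMonom (rcons t lx)).
Proof.
have := special_coef lx t lx; rewrite /= !mulr1n !mulr0n subrr add0r.
by move/eqP; rewrite subr_eq0 => /eqP.
Qed.

Lemma special_rot a t :
  G@_(FMonom (nseq a lx ++ t)) = G@_(FMonom (t ++ nseq a lx)).
Proof.
elim: a t => [|a IH] t; first by rewrite cats0.
by rewrite /= special_coef_xx rcons_cat IH cat_rcons.
Qed.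

Lemma special_push : push_invariant F.
Proof.
apply/push_invariantE => s; case: (last_y s) => [[a ->]|[u [[|a] ->]]].
- by rewrite push_word_nseq.
- by rewrite push_word_cat /= special_coef_yy cats1.
(* Writing F(w) for the coefficient of w: F(x x^a y u) = G(x^a y u y) = G(y u y x^a) = F(u y x^a
   x). *)
rewrite push_word_cat /= -special_coef_xy rcons_cat /= special_rot /=.
rewrite special_coef_yx -cats1 -!catA cat_rcons.
congr (F@_(FMonom (_ ++ _ :: _))).
by rewrite cats1; elim: (a) => //= b ->.
Qed.

End SpecialCoefficients.

Lemma coef_head_y a b s : (X * a + Y * b)@_(FMonom (ly :: s)) = b@_(FMonom s).
Proof.
transitivity ((X * a)@_(FMonom (ly :: s)) + (Y * b)@_(FMonom (ly :: s))).
  exact: mcoeffD.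
by rewrite !coefM_head mulr0n mulr1n add0r.
Qed.

Lemma coef_last_y a b s :
  (a * X + b * Y)@_(FMonom (rcons s ly)) = b@_(FMonom s).
Proof.
transitivity ((a * X)@_(FMonom (rcons s ly)) + (b * Y)@_(FMonom (rcons s ly))).
  exact: mcoeffD.
by rewrite !coefM_last mulr0n mulr1n add0r.
Qed.

(** On words ending in y, push carries s y to y s, which equates last-y and first-y coefficients. *)
Lemma push_invariant_cy F a' b' : push_invariant F -> F = X * a' + Y * b' ->
  nocst (F : nc_free) -> rcoef ly F = b'.
Proof.
move=> /push_invariantE pF F2 /nocstE F1; apply/malgP => -[s].
have := pF (rcons s ly); rewrite -cats1 (push_word_cat s 0) cats1.
by rewrite {1}F2 coef_head_y {1}F1 coef_last_y.
Qed.

Lemma sign_sq n : (-1) ^+ n * (-1) ^+ n = 1 :> rat.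
Proof. by rewrite -expr2 sqrr_sign. Qed.

(** * Lie polynomials of degree n *)

Section LieDegree.

Variables (n : nat) (P : ncpoly).
Hypotheses (n2 : (2 <= n)%N) (hP : lie_deg n P).

Let n0 : n%:R != 0 :> rat.
Proof. by rewrite Num.Theory.pnatr_eq0 -lt0n ltnW. Qed.

Let n1 : n%:R != 1 :> rat.
Proof. by rewrite Num.Theory.pnatr_eq1; case: eqP n2 => // ->. Qed.

Let predn : n%:R - 1 = n.-1%:R :> rat.
Proof. by rewrite -{1}(prednK (ltnW n2)) -natr1 addrK. Qed.

Let LP : @lie nc_free P.
Proof. by apply/is_lieE; case: hP. Qed.

Let EP : der X Y P = n%:R *: P.
Proof. by apply/homogE; case: hP. Qed.

(** The sign (-1)^(n-1) is the -1 of the antipode times the (-1)^n of the sign change in degree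
    n. *)
Lemma lie_left_decomp :
  P = X * ((-1) ^+ n.-1 *: anti (rcoef lx P))
    + Y * ((-1) ^+ n.-1 *: anti (rcoef ly P)).
Proof.
apply: (@at_left nc_free _ P (sign_sq n.-1) (lie_nocst LP)).
have aP := @lie_at nc_free (subst (- X) (- Y)) (subst_M _ _)
  (subst_X _ _) (subst_Y _ _) P LP.
have sP : subst (- X) (- Y) P = (-1) ^+ n *: P by apply: subst_sign; case: hP.
have -> : (-1) ^+ n.-1 = - (-1) ^+ n :> rat.
  by rewrite -[in RHS](prednK (ltnW n2)) exprS mulN1r opprK.
apply: etrans aP _; apply: etrans (congr1 -%R sP) _.
exact: esym (scaleNr _ _).
Qed.

Lemma homog_rcoef c : homog n.-1 (rcoef c P).
Proof.
apply/homogE; rewrite -predn; case: c.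
  exact: (@eu_cy nc_free _ _ (lie_nocst LP) EP).
exact: (@eu_cx nc_free _ _ (lie_nocst LP) EP).
Qed.

Lemma special_antipal G : br Y P + br X G = 0 ->
  antipalindromic n.-1 (rcoef ly P).
Proof.
move=> e; split; first exact: homog_rcoef.
exact: (@special_cy nc_free _ _ _ _ e (lie_nocst LP) lie_left_decomp).
Qed.

Lemma antipal_special : antipalindromic n.-1 (rcoef ly P) ->
  special_der n P (sprime (rcoef lx P)).
Proof.
case=> _ aP; have [N [-> dN]] := sprimeE (rcoef lx P).
(* Antipalindromy lets [rcoef ly P] itself stand as the left y-coefficient, the form [sp_special]
   asks for. *)
have dec := etrans lie_left_decomp (congr1 (fun b =>
  X * ((-1) ^+ n.-1 *: anti (rcoef lx P)) + Y * b) (esym aP)).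
have [LG EG e] := @sp_special nc_free _ N _ _ LP EP n0 n1 dN dec.
split; first exact: hP.
  by split; [apply/is_lieE; exact: LG|apply/homogE; exact: EG].
exact: etrans (addrC _ _) e.
Qed.

Lemma push_antipal : push_invariant P -> antipalindromic n.-1 (rcoef ly P).
Proof.
move=> pP; split; first exact: homog_rcoef.
exact: push_invariant_cy pP lie_left_decomp (lie_nocst LP).
Qed.

Lemma lie_deg_br_inj G : lie_deg n G -> br X P = br X G -> P = G.
Proof.
move=> [/is_lieE LG /homogE EG].
exact: (@lie_brkx_inj nc_free _ _ _ LP LG n1 EP EG).
Qed.

Let F := subst (- X - Y) Y P.

Let phi1 := subst_1 (- X - Y) Y.
Let phiM := subst_M (- X - Y) Y.
Let phix := subst_X (- X - Y) Y.
Let phiy := subst_Y (- X - Y) Y.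

Lemma lie_deg_subst : lie_deg n F.
Proof.
split; first exact/is_lieE/(@phi_lie nc_free _ phiM phix phiy).
apply/homogE; have := @eu_phi nc_free _ phi1 phiM phix phiy P.
by move=> /= e; rewrite /F e EP /subst linZ.
Qed.

Lemma rcoef_subst : rcoef ly F = subst (- X - Y) Y (rcoef ly P - rcoef lx P).
Proof. exact: (@cy_phi nc_free _ phiM phix phiy P (lie_nocst LP)). Qed.

Lemma homog_sub : homog n.-1 (rcoef ly P - rcoef lx P).
Proof.
apply/homogE; rewrite /der linB scalerBr; congr (_ - _); apply/homogE;
  exact: homog_rcoef.
Qed.

Lemma antipal_subst g : homog n.-1 g ->
  antipalindromic n.-1 g <->
  subst (- X - Y) Y g = (-1) ^+ n.-1 *: anti (subst (- X - Y) Y g).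
Proof.
move=> hg; have aphi := @at_phi nc_free _ phi1 phiM phix phiy g.
have pe : subst (- X - Y) Y ((-1) ^+ n.-1 *: anti g)
    = (-1) ^+ n.-1 *: anti (subst (- X - Y) Y g).
  exact: etrans (linZ _ _ _) (congr1 ( *:%R _) (esym aphi)).
split=> [[_ e]|e]; first exact: etrans (congr1 _ e) pe.
split; first exact: hg.
exact: can_inj (@phiK nc_free _ phi1 phiM phix phiy) _ _ (etrans e (esym pe)).
Qed.

End LieDegree.

Theorem theorem2p1 (n : nat) (hn : (3 <= n)%N) (f : ncpoly)
    (hf : lie_deg n f) :
  let F := subst (- X - Y) Y f in
  let f_x := rcoef lx f in
  let f_y := rcoef ly f in
  let F_x := rcoef lx F in
  let F_y := rcoef ly F in
  [<-> exists! G, lie_deg n G /\ br Y F + br X G = 0;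
       special_der n F (sprime F_x);
       antipalindromic n.-1 F_y;
       push_invariant F;
       antipalindromic n.-1 (f_y - f_x)].
Proof.
move=> F f_x f_y F_x F_y; have n2 : (2 <= n)%N by exact: ltnW.
have hF : lie_deg n F by exact: lie_deg_subst.
have v_iii : antipalindromic n.-1 (f_y - f_x) <-> antipalindromic n.-1 F_y.
  apply: iff_trans (antipal_subst (homog_sub n2 hf)) _.
  rewrite -(rcoef_subst hf); split=> [e|[]//].
  by split=> //; apply: homog_rcoef.
tfae.
- move=> [G [[_ e] _]]; exact/antipal_special/special_antipal/e.
- by move=> [_ _ e]; apply: (special_antipal n2 hF (G := sprime F_x));
     rewrite addrC.
- move/(antipal_special n2 hF) => [_ _ e].
  by apply: (special_push (G := sprime F_x)); rewrite addrC.
(* The last two links of the cycle, (iv) to (v) and (v) to (i), pass through (iii). *)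
- move=> h; exact: (iffRL v_iii (push_antipal n2 hF h)).
move=> h; have [_ hG e] := antipal_special n2 hF (iffLR v_iii h).
exists (sprime F_x); split=> [|G [hG' e']].
  by split; [exact: hG|exact: etrans (addrC _ _) e].
(* Both solutions have the same bracket with x, namely - [y, F]. *)
apply: (lie_deg_br_inj n2 hG hG'); apply: (@addrI _ (br Y F)).
exact: etrans (etrans (addrC _ _) e) (esym e').
Qed.
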